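(* Let $G$ be a graph with compact canonical decomposition $$G = (G_k, A_k, B_k) \circ (G_{k-1}, A_{k-1}, B_{k-1}) \circ \cdots \circ (G_1, A_1, B_1) \circ G_0.$$ Then a labeling $\phi$ of $V(G)$ is a distinguishing labeling of $G$ if and only if, for every $i = 0, 1, \dots, k$, the restriction of $\phi$ to $V(G_i)$ is a distinguishing labeling of $G_i$. Furthermore, $D(G) = \max\{D(G_i) : i = 0, \dots, k\}$.
   Context: All graphs are finite, simple and undirected. A $c$-labeling of $G$ is a map $\phi: V(G)\to\{1,\dots,c\}$. It is distinguishing if for every non-trivial automorphism $\pi$ of $G$ there is a vertex $v$ with $\phi(v)\neq\phi(\pi(v))$. The distinguishing number $D(G)$ is the smallest $c$ such that $G$ has a distinguishing $c$-labeling. A graph is split if its vertex set can be partitioned as $A\cup B$ with $A$ inducing a complete graph and $B$ a stable set (one of $A,B$ may be empty); $(A,B)$ is a $KS$-partition, and $(G,A,B)$ denotes a split graph $G$ with a fixed $KS$-partition $(A,B)$. If $V(G)\cap V(H)=\emptyset$, the composition $(G,A,B)\circ H$ is the graph with vertex set $V(G)\cup V(H)$ and edge set $E(G)\cup E(H)\cup\{uv: u\in A, v\in V(H)\}$. If $H$ is split with $KS$-partition $(C,D)$, then $(G,A,B)\circ(H,C,D)$ is the composition graph with $KS$-partition $(A\cup C,B\cup D)$; the operation is associative. A graph is decomposable if it equals $(G,A,B)\circ H$ with $G$ and $H$ each having at least one vertex; otherwise it is indecomposable. Canonical decomposition (Tyshkevich): every graph $G$ can be written as $(G_r,A_r,B_r)\circ\cdots\circ(G_1,A_1,B_1)\circ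 G_0$ with every $G_i$ indecomposable, and this is unique up to isomorphism (isomorphisms of triples $(G_i,A_i,B_i)$ respect the $KS$-partitions). A component is trivial if it has exactly one vertex. A trivial component $G_i$ with $i\ge 1$ has type $K_1$ if its vertex is in $A_i$ and type $S_1$ if its vertex is in $B_i$. If $G_0$ and $G_1$ are both trivial, $G_0$ is given the type of $G_1$; if $G_0$ is trivial but $G_1$ is non-trivial or does not exist, $G_0$ is given no type and is left alone. Compact canonical decomposition: obtained from the canonical decomposition by maximally combining consecutive trivial components of the same type: a maximal run of $m$ consecutive trivial components of type $K_1$ is replaced by the complete graph on those $m$ vertices with $KS$-partition (all vertices, $\emptyset$), and a maximal run of $m$ consecutive trivial components of type $S_1$ is replaced by the edgeless graph on those $m$ vertices with $KS$-partition ($\emptyset$, all vertices). (If the run includes the last component $G_0$, the result is the new last component.) Components are re-indexed from $k$ down to $0$. *)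

(* Defs.v *)
From HB Require Import structures.
From mathcomp Require Import all_boot all_fingroup.

Set Implicit Arguments.
Unset Strict Implicit.
Unset Printing Implicit Defensive.

Local Open Scope group_scope.
Local Open Scope nat_scope.

(* All graphs involved in a decomposition live inside one ambient finite type *)
(* [T] and have their own vertex set [vset], so that vertex-disjointness,     *)
(* unions and equality of graphs are literal.  An edge is a 2-element set.    *)
Record graph (T : finType) := Graph {
  vset : {set T};
  edges : {set {set T}};
  _ : [forall e in edges, (#|e| == 2) && (e \subset vset)]
}.

Definition adj (T : finType) (G : graph T) : rel T :=
  [rel u v | [set u; v] \in edges G].

Definition KS_partition (T : finType) (G : graph T) (A B : {set T}) : bool :=
  [&& A :|: B == vset G, [disjoint A & B],
      [forall u in A, forall v in A, (u != v) ==> adj G u v]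
    & [forall u in B, forall v in B, ~~ adj G u v]].

(* A split graph together with a fixed KS-partition (clique, stable). *)
Record split_graph (T : finType) := SplitGraph {
  sgraph :> graph T;
  clique : {set T};
  stable : {set T};
  splitP : KS_partition sgraph clique stable
}.

Section Labelings.
Variable T : finType.
Implicit Types (G : graph T) (phi : T -> nat) (p : {perm T}) (c : nat).

(* A permutation of V(G) is a permutation of [T] with support in V(G). *)
Definition automorphism G p : bool :=
  perm_on (vset G) p &&
  [forall u in vset G, forall v in vset G, adj G (p u) (p v) == adj G u v].

(* Labelings are functions on [T]; only the values on V(G) are constrained or *)
(* inspected, so restricting a labeling to a subgraph needs no operation.     *)
Definition labeling c G phi : bool :=
  [forall v in vset G, 1 <= phi v <= c].

Definition distinguishing G phi : bool :=
  [forall p : {perm T}, (automorphism G p && (p != 1%g)) ==>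
     [exists v in vset G, phi v != phi (p v)]].

(* The values lie in {0, ..., c} only to have a finite type of candidates:    *)
(* [labeling] excludes 0 on V(G).  See [has_distinguishing_labelingP].        *)
Definition has_distinguishing_labeling G c : bool :=
  [exists f : {ffun T -> 'I_c.+1},
     labeling c G (fun v => f v) && distinguishing G (fun v => f v)].

Lemma has_distinguishing_labelingP G c :
  reflect (exists2 phi : T -> nat, labeling c G phi & distinguishing G phi)
          (has_distinguishing_labeling G c).
Proof.
apply: (iffP existsP) => [[f /andP[lf df]]|[phi lphi dphi]].
  by exists (fun v => nat_of_ord (f v)).
have fE v : v \in vset G -> (inord (phi v) : 'I_c.+1) = phi v :> nat.
  by move=> vG; rewrite inordK // ltnS; case/andP: (implyP (forallP lphi v) vG).
exists [ffun v => inord (phi v)]; apply/andP; split.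
  by apply/forall_inP => v vG; rewrite ffunE fE //; apply: (forall_inP lphi).
apply/forall_inP => p pG; move: (pG) => /andP[/andP[pV _] _].
have /exists_inP[v vG neq] := forall_inP dphi p pG.
by apply/exists_inP; exists v => //; rewrite !ffunE !fE ?(perm_closed _ pV).
Qed.

Lemma has_distinguishing_labeling_ex G :
  exists c, has_distinguishing_labeling G c.
Proof.
exists #|T|; apply/has_distinguishing_labelingP.
exists (fun v => (enum_rank v).+1).
  by apply/forall_inP => v _; exact: ltn_ord.
apply/forall_inP => p /andP[/andP[pV _] p1]; apply: contraR p1 => /exists_inPn ndi.
apply/eqP/permP => v; rewrite perm1.
have [vG|vG] := boolP (v \in vset G); last exact: out_perm pV vG.
by move: (ndi v vG); rewrite negbK eqSS => /eqP/val_inj/enum_rank_inj.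
Qed.

Definition distinguishing_number G : nat :=
  ex_minn (has_distinguishing_labeling_ex G).

End Labelings.

Section Composition.
Variable T : finType.
Implicit Types (G H : graph T) (C : split_graph T) (S : {set T}).

Definition compose_edges C H : {set {set T}} :=
  edges C :|: edges H
    :|: [set [set u; v] | u in clique C, v in vset H & u != v].

Lemma compose_subproof C H :
  [forall e in compose_edges C H,
     (#|e| == 2) && (e \subset vset C :|: vset H)].
Proof.
apply/forall_inP => e; rewrite !inE -orbA => /or3P[eC|eH|/imset2P[u v uA]].
- case: (sgraph C) eC => V E /= wf /(forall_inP wf)/andP[-> /= sV].
  by rewrite (subset_trans sV) ?subsetUl.
- case: H eH => V E /= wf /(forall_inP wf)/andP[-> /= sV].
  by rewrite (subset_trans sV) ?subsetUr.
rewrite inE => /andP[vH uv] ->; rewrite cards2 uv /= subUset !sub1set !inE vH orbT andbT.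
by case/and4P: (splitP C) => /eqP<- _ _ _; rewrite inE uA.
Qed.

(* The composition (G, A, B) o H.  It is meant for vertex-disjoint arguments, *)
(* for which the side condition [u != v] of [compose_edges] is automatic.     *)
Definition compose C H : graph T := Graph (compose_subproof C H).

Definition decomposable G : Prop :=
  exists C H, [/\ vset C != set0, vset H != set0,
                  [disjoint vset C & vset H] & G = compose C H].

Lemma complete_subproof S :
  [forall e in [set e : {set T} | (#|e| == 2) && (e \subset S)],
     (#|e| == 2) && (e \subset S)].
Proof. by apply/forall_inP => e; rewrite inE. Qed.

Definition complete_graph S : graph T := Graph (complete_subproof S).

Lemma edgeless_subproof S :
  [forall e in (set0 : {set {set T}}), (#|e| == 2) && (e \subset S)].
Proof. by apply/forall_inP => e; rewrite inE. Qed.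

Definition edgeless_graph S : graph T := Graph (edgeless_subproof S).

Lemma complete_splitP S : KS_partition (complete_graph S) S set0.
Proof.
apply/and4P; split; rewrite ?setU0 ?disjoints0 //=.
- by rewrite disjoint_sym disjoints_subset sub0set.
- apply/forall_inP => u uS; apply/forall_inP => v vS; apply/implyP => uv.
  by rewrite /adj /= inE cards2 uv subUset !sub1set uS vS.
by apply/forall_inP => u; rewrite inE.
Qed.

Definition complete_split S : split_graph T := SplitGraph (complete_splitP S).

Lemma edgeless_splitP S : KS_partition (edgeless_graph S) set0 S.
Proof.
apply/and4P; split; rewrite ?set0U //=.
- by rewrite disjoints_subset sub0set.
- by apply/forall_inP => u; rewrite inE.
by apply/forall_inP => u uS; apply/forall_inP => v vS; rewrite /adj /= inE.
Qed.

Definition edgeless_split S : split_graph T := SplitGraph (edgeless_splitP S).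

End Composition.

Section Decomposition.
Variable T : finType.
Implicit Types (G : graph T) (C : split_graph T) (cs : seq (split_graph T)).

(* A decomposition (G_r, A_r, B_r) o ... o (G_1, A_1, B_1) o G_0 is given by  *)
(* [cs] = [:: (G_r, A_r, B_r); ...; (G_1, A_1, B_1)] and [G0]; thus           *)
(* r = [size cs], and [component cs G0 i] is G_i for i <= r.                  *)
Definition component cs G0 (i : nat) : graph T :=
  nth G0 (G0 :: rev [seq sgraph C | C <- cs]) i.

(* Components have at least one vertex, except that the graph without         *)
(* vertices is its own (only) component.                                      *)
Definition canonical_decomposition G cs G0 : Prop :=
  [/\ G = foldr (@compose T) G0 cs,
      pairwise [rel H K : graph T | [disjoint vset H & vset K]]
        (rcons [seq sgraph C | C <- cs] G0),
      forall i, i <= size cs -> ~ decomposable (component cs G0 i)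
    & 0 < size cs ->
      forall i, i <= size cs -> vset (component cs G0 i) != set0].

Definition trivial_graph G : bool := #|vset G| == 1.

(* [Some true] stands for type K_1 and [Some false] for type S_1. *)
Definition component_type C : option bool :=
  if trivial_graph C then Some (clique C != set0) else None.

(* The type of the component that follows [C] in [C :: cs], G0; when          *)
(* [cs] is empty, [C] is G_1, whose type a trivial G_0 inherits.              *)
Definition next_type C cs G0 : option bool :=
  if cs is C' :: _ then component_type C'
  else if trivial_graph G0 then component_type C else None.

(* In the merging case [C] is prepended to the run that makes up the first    *)
(* component of the compact form of the tail; that component is the last one  *)
(* exactly when no split component remains before it.                         *)
Fixpoint compact cs G0 : seq (split_graph T) * graph T :=
  if cs is C :: cs' then
    let: (ds, H) := compact cs' G0 in
    match component_type C, ds with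
    | Some b, D :: ds' =>
      if next_type C cs' G0 == Some b then
        let S := vset C :|: vset D in
        ((if b then complete_split S else edgeless_split S) :: ds', H)
      else (C :: ds, H)
    | Some b, [::] =>
      if next_type C cs' G0 == Some b then
        let S := vset C :|: vset H in
        ([::], if b then complete_graph S else edgeless_graph S)
      else (C :: ds, H)
    | None, _ => (C :: ds, H)
    end
  else ([::], G0).

Definition compact_canonical_decomposition G cs G0 : Prop :=
  exists ds H0, canonical_decomposition G ds H0 /\ compact ds H0 = (cs, G0).

End Decomposition.

(* Main.v *)
Require Import Defs.
From mathcomp Require Import all_boot.
From mathcomp Require Import all_fingroup.

Set Implicit Arguments.
Unset Strict Implicit.
Unset Printing Implicit Defensive.

(* In C o R, every vertex of the clique A of C is adjacent to all of A and R, *)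
(* and every vertex of the stable part B sees only A; hence degrees satisfy   *)
(* deg A >= deg R >= deg B.  Both inequalities are strict if C is             *)
(* indecomposable with at least two vertices, if C is complete and R has no   *)
(* dominating vertex, or if C is edgeless and R has no isolated vertex; the   *)
(* compact decomposition only contains these three situations.  Automorphisms *)
(* preserve degrees, so they preserve A, B and V(R) and restrict to C and R.  *)
(* The same degree count inside C shows that automorphisms of C preserve A,   *)
(* so, extended by the identity on R, they are automorphisms of C o R.        *)

Local Open Scope nat_scope.

(** * Adjacency, KS-partitions and a criterion for decomposability *)

Section Graphs.
Variable T : finType.
Implicit Types (G H R : graph T) (C D : split_graph T) (S X Y : {set T}).
Implicit Types (p : {perm T}) (phi : T -> nat) (u v w : T).

(** The proof peels off one component at a time. For a single composition C o R,
    [distinguishing_compose] shows that a labeling distinguishes C o R exactly when it distinguishes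
    C and R, provided that C is [separating] from R. This rests on two facts. Degrees separate the
    clique of C, the vertices of R and the stable part of C ([degree_lt_clique],
    [degree_lt_stable]), so every automorphism of C o R restricts to C and to R. Conversely,
    automorphisms of C or R extend by the identity ([aut_extend_left], which needs
    [separating_rigid], and [aut_extend_right]). Induction along the composition then gives both
    halves of the theorem; for the second half, optimal labelings of C and R are glued.

    Compaction matters because two consecutive trivial components of equal type hold twin vertices,
    which an automorphism may swap. Once runs are merged, each run of type K_1 is followed by a
    graph without dominating vertex, and each run of type S_1 by a graph without isolated vertex. A
    component with at least two vertices that is indecomposable satisfies [tight] instead.
    [compact_spec] proves that compaction leaves the composed graph unchanged and makes every
    component separating from what follows. *)

Lemma edgeP G e : e \in edges G -> (#|e| == 2) && (e \subset vset G).
Proof. by case: G => V E /= /forall_inP; apply. Qed.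

Lemma adj_sym G u v : adj G u v = adj G v u.
Proof. by rewrite /adj /= setUC. Qed.

Lemma adj_neq G u v : adj G u v -> u != v.
Proof. by move/edgeP/andP=> []; rewrite cards2; case: (u != v). Qed.

Lemma adj_irr G v : adj G v v = false.
Proof. by apply/negP => /adj_neq; rewrite eqxx. Qed.

Lemma adj_vset G u v : adj G u v -> (u \in vset G) && (v \in vset G).
Proof. by move/edgeP/andP=> [_]; rewrite subUset !sub1set. Qed.

Lemma adj_vsetl G u v : adj G u v -> u \in vset G.
Proof. by case/adj_vset/andP. Qed.

Lemma adj_vsetr G u v : adj G u v -> v \in vset G.
Proof. by case/adj_vset/andP. Qed.

(** Every edge is a pair, so adjacency determines the edge set; the well-formedness field is a
    Boolean equation, hence proof-irrelevant. *)
Lemma graph_ext G H : vset G = vset H -> adj G =2 adj H -> G = H.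
Proof.
move=> eV eA; have eE : edges G = edges H.
  apply/setP => e; apply/idP/idP => eG; have /andP[/cards2P[u [v [_ eE]]] _] := edgeP eG.
    by move: (eA u v); rewrite /adj /= -eE eG.
  by move: (eA u v); rewrite /adj /= -eE eG.
case: G H eV eE {eA} => V E wf [V' E' wf'] /= eV eE; case: _ / eV wf' => wf'.
by case: _ / eE wf' => wf'; congr Graph; apply: bool_irrelevance.
Qed.

Lemma vsetE C : vset C = clique C :|: stable C.
Proof. by case/and4P: (Defs.splitP C) => /eqP. Qed.

Lemma clique_vset C v : v \in clique C -> v \in vset C.
Proof. by rewrite vsetE inE => ->. Qed.

Lemma stable_vset C v : v \in stable C -> v \in vset C.
Proof. by rewrite vsetE inE orbC => ->. Qed.

Lemma cliqueF C v : v \in stable C -> (v \in clique C) = false.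
Proof.
by case/and4P: (Defs.splitP C) => _ dj _ _ vB; apply: contraTF vB => /(disjointFr dj)->.
Qed.

Lemma clique_adj C u v : u \in clique C -> v \in clique C -> u != v -> adj C u v.
Proof.
case/and4P: (Defs.splitP C) => _ _ /forall_inP cl _ uA vA.
by move/forall_inP: (cl u uA) => /(_ v vA)/implyP; apply.
Qed.

Lemma stable_nadj C u v : u \in stable C -> v \in stable C -> adj C u v = false.
Proof.
case/and4P: (Defs.splitP C) => _ _ _ /forall_inP st uB vB.
by move/forall_inP: (st u uB) => /(_ v vB)/negbTE.
Qed.

Lemma set2_inj u v x y :
  [set u; v] = [set x; y] -> (u = x /\ v = y) \/ (u = y /\ v = x).
Proof.
move=> e.
have /set2P uE : u \in [set x; y] by rewrite -e set21.
have /set2P vE : v \in [set x; y] by rewrite -e set22.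
have /set2P xE : x \in [set u; v] by rewrite e set21.
have /set2P yE : y \in [set u; v] by rewrite e set22.
by intuition congruence.
Qed.

Lemma adj_compose C H u v :
  adj (compose C H) u v =
  [|| adj C u v, adj H u v |
      (u != v) && ((u \in clique C) && (v \in vset H)
                   || (v \in clique C) && (u \in vset H))].
Proof.
rewrite {1}/adj /= !inE -orbA; congr [|| _, _ | _].
apply/imset2P/andP => [[x y xA]|[uv]].
  rewrite inE => /andP[yH xy] /set2_inj[[-> ->]|[-> ->]].
    by rewrite xA yH xy.
  by rewrite xA yH eq_sym xy orbT.
case/orP=> /andP[A V]; first by exists u v; rewrite ?inE ?V.
by exists v u; rewrite ?inE ?V ?[v == u]eq_sym // setUC.
Qed.

Lemma induced_subproof G S :
  [forall e in [set e in edges G | e \subset S],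
     (#|e| == 2) && (e \subset vset G :&: S)].
Proof.
by apply/forall_inP => e; rewrite inE subsetI => /andP[/edgeP/andP[-> ->]].
Qed.

Definition induced G S : graph T := Graph (induced_subproof G S).

Lemma adj_induced G S u v :
  adj (induced G S) u v = [&& adj G u v, u \in S & v \in S].
Proof. by rewrite /adj /= inE subUset !sub1set. Qed.

(** The witnesses are the subgraphs induced by X and Y together and by the remaining vertices. Used
    contrapositively, it turns indecomposability into local conditions on single vertices. *)
Lemma decomposable_intro G X Y :
    X :|: Y \subset vset G -> [disjoint X & Y] ->
    X :|: Y != set0 -> vset G :\: (X :|: Y) != set0 ->
    {in X &, forall u v, u != v -> adj G u v} ->
    {in Y &, forall u v, ~~ adj G u v} ->
    {in X & vset G :\: (X :|: Y), forall u v, adj G u v} ->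
    {in Y & vset G :\: (X :|: Y), forall u v, ~~ adj G u v} ->
  decomposable G.
Proof.
move=> sV dXY nXY nZ clX stY adXZ nYZ.
have ks : KS_partition (induced G (X :|: Y)) X Y.
  apply/and4P; split=> //=; first by rewrite (setIidPr sV).
    apply/forall_inP => u uX; apply/forall_inP => v vX; apply/implyP => uv.
    by rewrite adj_induced clX // !inE uX vX.
  apply/forall_inP => u uY; apply/forall_inP => v vY.
  by rewrite adj_induced negb_and stY.
set Z := vset G :\: (X :|: Y) in nZ adXZ nYZ.
exists (SplitGraph ks), (induced G Z).
have eZ : vset G :&: Z = Z by rewrite /Z; apply/setIidPr/subsetDl.
split => //=; rewrite ?(setIidPr sV) ?eZ //.
  by rewrite disjoint_sym disjoints_subset /Z setDE subsetIr.
apply: graph_ext => [|u v] /=.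
  by rewrite (setIidPr sV) eZ /Z setDE setUIr setUCr setIT (setUidPr sV).
rewrite adj_compose /= !adj_induced eZ.
have [uvV|] := boolP ((u \in vset G) && (v \in vset G)); last first.
  move=> nV; have -> : adj G u v = false by apply: contraNF nV => /adj_vset.
  apply/esym/negP => /= /andP[_]; apply/negP; apply: contraNN nV.
  have XV := subsetP (subset_trans (subsetUl _ _) sV).
  by case/orP=> /andP[/XV->]; rewrite !inE => /andP[_ ->].
have [<-|uv] := eqVneq u v; first by rewrite adj_irr.
case/andP: uvV => uV vV /=.
have inZ w : w \in vset G -> (w \in Z) = (w \notin X :|: Y).
  by rewrite /Z in_setD => ->; rewrite andbT.
have XF w : w \notin X :|: Y -> (w \in X) = false.
  by rewrite inE => /norP[/negbTE].
rewrite !inZ //.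
have [uS|uS] := boolP (u \in X :|: Y); have [vS|vS] := boolP (v \in X :|: Y).
- by rewrite !andbF !andbT !orbF.
- have vZ : v \in Z by rewrite inZ.
  rewrite (XF v) // !andbF !andbT /= orbF.
  case/setUP: (uS) => [uX|uY]; first by rewrite uX adXZ.
  by rewrite (negbTE (nYZ _ _ uY vZ)) (disjointFl dXY uY).
- have uZ : u \in Z by rewrite inZ.
  rewrite (XF u) // !andbF !andbT /=.
  case/setUP: (vS) => [vX|vY]; first by rewrite vX adj_sym adXZ.
  by rewrite adj_sym (negbTE (nYZ _ _ vY uZ)) (disjointFl dXY vY).
by rewrite (XF u) // (XF v) // !andbF !andbT /= orbF.
Qed.

(** * Local consequences of indecomposability *)

Definition no_dominating G :=
  {in vset G, forall v, exists2 u, u \in vset G & (u != v) && ~~ adj G v u}.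

Definition no_isolated G := {in vset G, forall v, exists u, adj G v u}.

(** The trace of indecomposability that the degree counts use: each side of the partition has a
    witness that makes a degree inequality strict. *)
Definition tight C :=
  {in clique C, forall a, exists2 b, b \in stable C & adj C a b} /\
  {in stable C, forall b, exists2 a, a \in clique C & ~~ adj C b a}.

Section Indecomposable.
Variable G : graph T.
Hypotheses (indG : ~ decomposable G) (ntG : 1 < #|vset G|).

Lemma nontrivial_remove v : v \in vset G -> vset G :\ v != set0.
Proof. by move: ntG; rewrite (cardsD1 v) -card_gt0 => + vG; rewrite vG. Qed.

Lemma indecomposable_no_dominating : no_dominating G.
Proof.
move=> v vG; apply/exists_inP; apply: contraT => /exists_inPn dom; case: indG.
apply: (@decomposable_intro _ [set v] set0); rewrite ?setU0 ?sub1set //.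
- by rewrite disjoint_sym disjoints_subset sub0set.
- by apply/set0Pn; exists v; rewrite set11.
- exact: nontrivial_remove.
- by move=> u w /set1P-> /set1P->; rewrite eqxx.
- by move=> u w; rewrite inE.
- by move=> u w /set1P-> /setD1P[wv /dom]; rewrite wv /= negbK.
by move=> u w; rewrite inE.
Qed.

Lemma indecomposable_no_isolated : no_isolated G.
Proof.
move=> v vG; apply/existsP; apply: contraT => /existsPn iso; case: indG.
apply: (@decomposable_intro _ set0 [set v]); rewrite ?set0U ?sub1set //.
- by rewrite disjoints_subset sub0set.
- by apply/set0Pn; exists v; rewrite set11.
- exact: nontrivial_remove.
- by move=> u w; rewrite inE.
- by move=> u w /set1P-> /set1P->.
- by move=> u w; rewrite inE.
by move=> u w /set1P->.
Qed.

End Indecomposable.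

(** A vertex v violating either clause is adjacent to all other clique vertices and to no other
    stable vertex, so it can be split off as the last component: C is the composition of C minus v
    with the single vertex v. *)
Lemma indecomposable_tight C : ~ decomposable C -> 1 < #|vset C| -> tight C.
Proof.
move=> indC ntC; split=> v vS; apply/exists_inP; apply: contraT => /exists_inPn nv;
  case: indC; have vC : v \in vset C by rewrite vsetE inE vS ?orbT.
- have vB : (v \in stable C) = false by apply/negP => /cliqueF; rewrite vS.
  have eS : (clique C :\ v) :|: stable C = vset C :\ v.
    by apply/setP => w; rewrite vsetE !inE; case: eqP => // ->; rewrite vB.
  have eZ : vset C :\: ((clique C :\ v) :|: stable C) = [set v].
    by rewrite eS setDDr setDv set0U; apply/setIidPr; rewrite sub1set.
  apply: (@decomposable_intro _ (clique C :\ v) (stable C)); rewrite ?eZ.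
  - by rewrite eS subsetDl.
  - rewrite disjoint_sym disjoints_subset; apply/subsetP => w wB.
    by rewrite !inE cliqueF // andbF.
  - by rewrite eS nontrivial_remove.
  - by apply/set0Pn; exists v; rewrite set11.
  - by move=> u w /setD1P[_ uA] /setD1P[_ wA]; apply: clique_adj.
  - by move=> u w uB wB; rewrite stable_nadj.
  - by move=> u w /setD1P[uv uA] /set1P->; apply: clique_adj.
  by move=> u w uB /set1P->; rewrite adj_sym nv.
have vA : (v \in clique C) = false by apply: cliqueF.
have eS : clique C :|: (stable C :\ v) = vset C :\ v.
  by apply/setP => w; rewrite vsetE !inE; case: eqP => // ->; rewrite vA.
have eZ : vset C :\: (clique C :|: (stable C :\ v)) = [set v].
  by rewrite eS setDDr setDv set0U; apply/setIidPr; rewrite sub1set.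
apply: (@decomposable_intro _ (clique C) (stable C :\ v)); rewrite ?eZ.
- by rewrite eS subsetDl.
- rewrite disjoint_sym disjoints_subset; apply/subsetP => w /setD1P[_ wB].
  by rewrite !inE cliqueF.
- by rewrite eS nontrivial_remove.
- by apply/set0Pn; exists v; rewrite set11.
- by move=> u w; apply: clique_adj.
- by move=> u w /setD1P[_ uB] /setD1P[_ wB]; rewrite stable_nadj.
- by move=> u w uA /set1P->; rewrite adj_sym -[adj _ _ _]negbK nv.
by move=> u w /setD1P[_ uB] /set1P->; rewrite stable_nadj.
Qed.

(** * Degrees and automorphisms *)

Definition degree G v := #|[set u | adj G v u]|.

Lemma aut_closed G p v : automorphism G p -> (p v \in vset G) = (v \in vset G).
Proof. by case/andP=> /perm_closed->. Qed.

Lemma aut_adj G p u v : automorphism G p -> adj G (p u) (p v) = adj G u v.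
Proof.
move=> pG; have [uV|nu] := boolP (u \in vset G); last first.
  by apply/idP/idP => /adj_vsetl; rewrite ?aut_closed // (negbTE nu).
have [vV|nv] := boolP (v \in vset G); last first.
  by apply/idP/idP => /adj_vsetr; rewrite ?aut_closed // (negbTE nv).
by case/andP: pG => _ /forall_inP/(_ u uV)/forall_inP/(_ v vV)/eqP.
Qed.

Lemma aut_degree G p v : automorphism G p -> degree G (p v) = degree G v.
Proof.
move=> pG; rewrite /degree -[RHS](card_imset _ (@perm_inj _ p)); apply: eq_card => u.
rewrite -[u](permKV p) inE aut_adj //; apply/idP/imsetP => [vu|[w]].
  by exists ((p^-1)%g u); rewrite ?inE.
by rewrite inE => + /perm_inj->.
Qed.

(** Automorphisms preserve degrees, so no vertex can cross between S and its complement when the two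
    share no degree. *)
Lemma aut_stab_degree G p S : automorphism G p -> S \subset vset G ->
    {in S & vset G :\: S, forall x y, degree G x != degree G y} ->
  forall v, (p v \in S) = (v \in S).
Proof.
move=> pG sS dS v; have vV := aut_closed v pG.
have [vS|nvS] := boolP (v \in S).
  apply: contraT => npv; have := dS v (p v) vS; rewrite aut_degree // eqxx.
  by rewrite inE npv vV (subsetP sS) // => /(_ isT).
apply/negP => pv; have := dS (p v) v pv; rewrite aut_degree // eqxx.
by rewrite inE nvS -vV (subsetP sS) // => /(_ isT).
Qed.

(** In C o R, a vertex of C sees either all of R or nothing of R, according to its side; an
    automorphism of C extends by the identity exactly when it respects the sides, if R is
    nonempty. *)
Definition rigid C :=
  forall p, automorphism C p -> forall v, (p v \in clique C) = (v \in clique C).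

(** With A the clique, a stable vertex misses some clique vertex and has degree below |A|, while a
    clique vertex has a stable neighbour and thus degree at least |A|. *)
Lemma tight_rigid C : tight C -> rigid C.
Proof.
move=> [tA tB] p pC; apply: (aut_stab_degree pC).
  by apply/subsetP => v; apply: clique_vset.
move=> a b aA /setDP[]; rewrite vsetE inE orbC => /orP[bB _|->] //.
suff : degree C b < degree C a by rewrite neq_ltn orbC => ->.
have [b' b'B ab'] := tA a aA; have [a' a'A ba'] := tB b bB.
have lt_bA : degree C b < #|clique C|.
  apply/proper_card/properP; split; last by exists a'; rewrite ?inE.
  apply/subsetP => u; rewrite inE => bu; have := adj_vsetr bu.
  by rewrite vsetE inE => /orP[//|uB]; rewrite stable_nadj in bu.
(* The closed neighbourhood of [a] contains A and the stable neighbour [b']; cancelling one on each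
   side leaves |A| <= deg a. *)
have : #|b' |: clique C| <= #|a |: [set u | adj C a u]|.
  apply/subset_leq_card/subsetP => u; rewrite !inE.
  have [->|ub'] := eqVneq u b'; first by rewrite ab' orbT.
  by move=> /= uA; have [//|ua] := eqVneq u a; rewrite clique_adj // eq_sym.
rewrite !cardsU1 inE adj_irr cliqueF // !add1n => le_Aa.
exact: leq_trans lt_bA le_Aa.
Qed.

(* With [stable C = set0], [C] is a run of type K_1; with [clique C = set0],  *)
(* a run of type S_1.                                                         *)
Definition separating C R :=
  [/\ [disjoint vset C & vset R], vset R != set0 &
    [\/ tight C, stable C = set0 /\ no_dominating R
      | clique C = set0 /\ no_isolated R]].

(** * A single composition C o R *)

Section Compose.
Variables (C : split_graph T) (R : graph T).
Hypothesis djCR : [disjoint vset C & vset R].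

Lemma adj_compose_left u v :
  u \in vset C -> v \in vset C -> adj (compose C R) u v = adj C u v.
Proof.
move=> uC vC; have [uR vR] := (disjointFr djCR uC, disjointFr djCR vC).
rewrite adj_compose uR vR !andbF orbF.
by case: (boolP (adj R u v)) => [/adj_vsetl|]; rewrite ?uR ?orbF.
Qed.

Lemma adj_compose_cross u v :
  u \in vset C -> v \in vset R -> adj (compose C R) u v = (u \in clique C).
Proof.
move=> uC vR; have [uR vC] := (disjointFr djCR uC, disjointFl djCR vR).
have uv : u != v by apply: contraFneq uR => ->.
have vA : (v \in clique C) = false by apply: contraFF vC => /clique_vset.
rewrite adj_compose uv uR vR vA andbT /= orbF.
by case: (boolP (adj C u v)) => [/adj_vsetr|_]; rewrite ?vC //;
   case: (boolP (adj R u v)) => [/adj_vsetl|]; rewrite ?uR.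
Qed.

Lemma adj_compose_right u v :
  u \in vset R -> v \in vset R -> adj (compose C R) u v = adj R u v.
Proof.
move=> uR vR; have [uC vC] := (disjointFl djCR uR, disjointFl djCR vR).
have vA : (v \in clique C) = false by apply: contraFF vC => /clique_vset.
have uA : (u \in clique C) = false by apply: contraFF uC => /clique_vset.
rewrite adj_compose uA vA andbF orbF.
by case: (boolP (adj C u v)) => [/adj_vsetl|_]; rewrite ?uC.
Qed.

Lemma vset_compose v :
  (v \in vset (compose C R)) = (v \in vset C) || (v \in vset R).
Proof. by rewrite inE. Qed.

Lemma adj_right_cases u v : u \in vset R -> adj (compose C R) u v ->
  (v \in clique C) || (v \in vset R).
Proof.
move=> uR uv; have := adj_vsetr uv; rewrite vset_compose => /orP[vC|->].
  by rewrite adj_sym adj_compose_cross // in uv; rewrite uv.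
by rewrite orbT.
Qed.

Lemma adj_stable_clique u v : u \in stable C -> adj (compose C R) u v ->
  v \in clique C.
Proof.
move=> uB uv; have uC := stable_vset uB; have := adj_vsetr uv.
rewrite vset_compose => /orP[vC|vR]; last first.
  by rewrite adj_compose_cross // cliqueF in uv.
rewrite adj_compose_left // in uv; move: vC; rewrite vsetE inE => /orP[//|vB].
by rewrite stable_nadj in uv.
Qed.

Hypothesis nR : vset R != set0.
Hypothesis sepCR : [\/ tight C, stable C = set0 /\ no_dominating R
                     | clique C = set0 /\ no_isolated R].

Lemma degree_lt_clique a v : a \in clique C -> v \in vset R ->
  degree (compose C R) v < degree (compose C R) a.
Proof.
move=> aA vR; set G := compose C R; have aC := clique_vset aA.
(* As [a] and [v] are adjacent, their open neighbourhoods are incomparable; closed ones are nested,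
   and each exceeds the degree by one. *)
suff : v |: [set u | adj G v u] \proper a |: [set u | adj G a u].
  by move/proper_card; rewrite !cardsU1 !inE !adj_irr.
have adjA u : u \in clique C -> (u == a) || adj G a u.
  move=> uA; have [//|ua] := eqVneq u a.
  by rewrite adj_compose_left ?clique_vset // clique_adj // eq_sym.
have adjR u : u \in vset R -> adj G a u by move=> uR; rewrite adj_compose_cross.
apply/properP; split.
  apply/subsetP => u; rewrite !inE => /orP[/eqP->|/(adj_right_cases vR)].
    by rewrite adjR ?orbT.
  by case/orP=> [/adjA//|/adjR->]; rewrite orbT.
case: sepCR => [[tA _]|[_ /(_ v vR)[r rR /andP[rv nvr]]]|[A0]]; last first.
- by rewrite A0 inE in aA.
- exists r; first by rewrite !inE adjR ?orbT.
  by rewrite !inE negb_or rv adj_compose_right.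
have [b bB ab] := tA a aA; have bC := stable_vset bB.
exists b; first by rewrite !inE adj_compose_left // ab orbT.
rewrite !inE negb_or adj_sym adj_compose_cross // cliqueF // andbT.
by apply: contraTneq vR => <-; rewrite (disjointFr djCR).
Qed.

(** All neighbours of [b] lie in the clique of C, which [v] sees entirely. Strictness comes from a
    clique vertex missed by [b], or from a neighbour of [v] inside R. *)
Lemma degree_lt_stable b v : b \in stable C -> v \in vset R ->
  degree (compose C R) b < degree (compose C R) v.
Proof.
move=> bB vR; set G := compose C R; have bC := stable_vset bB.
have adjA u : u \in clique C -> adj G v u.
  by move=> uA; rewrite adj_sym adj_compose_cross ?clique_vset.
apply/proper_card/properP; split.
  by apply/subsetP => u; rewrite !inE => /(adj_stable_clique bB)/adjA.
case: sepCR => [[_ tB]|[B0]|[A0 /(_ v vR)[r vr]]].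
- have [a aA ba] := tB b bB; have aC := clique_vset aA.
  by exists a; rewrite inE ?adjA // adj_compose_left.
- by rewrite B0 inE in bB.
have rR := adj_vsetr vr; exists r; rewrite inE; first by rewrite adj_compose_right.
by rewrite adj_compose_cross // A0 inE.
Qed.

Lemma degree_lt_stable_clique a b : a \in clique C -> b \in stable C ->
  degree (compose C R) b < degree (compose C R) a.
Proof.
have [v vR] := set0Pn _ nR => aA bB.
exact: ltn_trans (degree_lt_stable bB vR) (degree_lt_clique aA vR).
Qed.

(** For a run of trivial components the clique is all of C or empty, hence trivially invariant. *)
Lemma separating_rigid : rigid C.
Proof.
case: sepCR => [|[B0 _]|[A0 _] p _ v]; first exact: tight_rigid.
  move=> p pC v; have vE : clique C = vset C by rewrite vsetE B0 setU0.
  by rewrite vE (aut_closed v pC).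
by rewrite A0 !inE.
Qed.

Section Automorphism.
Variable p : {perm T}.
Hypothesis pG : automorphism (compose C R) p.

Lemma aut_compose_clique v : (p v \in clique C) = (v \in clique C).
Proof.
apply: (aut_stab_degree pG) v.
  by apply/subsetP => v vA; rewrite vset_compose clique_vset.
move=> a v aA /setDP[]; rewrite vset_compose vsetE inE.
case/orP=> [/orP[->//|vB]|vR] _.
  by rewrite neq_ltn (degree_lt_stable_clique aA vB) orbT.
by rewrite neq_ltn (degree_lt_clique aA vR) orbT.
Qed.

Lemma aut_compose_stable v : (p v \in stable C) = (v \in stable C).
Proof.
apply: (aut_stab_degree pG) v.
  by apply/subsetP => v vB; rewrite vset_compose stable_vset.
move=> b v bB /setDP[]; rewrite vset_compose vsetE inE.
case/orP=> [/orP[vA|->//]|vR] _.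
  by rewrite neq_ltn (degree_lt_stable_clique vA bB).
by rewrite neq_ltn (degree_lt_stable bB vR).
Qed.

Lemma aut_compose_left v : (p v \in vset C) = (v \in vset C).
Proof. by rewrite vsetE !inE aut_compose_clique aut_compose_stable. Qed.

Lemma aut_compose_right v : (p v \in vset R) = (v \in vset R).
Proof.
have := aut_closed v pG; rewrite !vset_compose aut_compose_left.
have [vC _|_ //] := boolP (v \in vset C).
by rewrite !(disjointFr djCR) ?aut_compose_left.
Qed.

Lemma restr_aut H :
    {in vset H &, forall u v, adj (compose C R) u v = adj H u v} ->
    (forall v, (p v \in vset H) = (v \in vset H)) ->
  automorphism H (restr_perm (vset H) p) /\
    {in vset H, restr_perm (vset H) p =1 p}.
Proof.
move=> adjH pH.
(* Membership in the setwise stabiliser is what makes [restr_perm] agree with [p] on the vertex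
   set. *)
have nH : (p \in 'N(vset H | 'P))%g.
  rewrite inE; apply/andP; split; first by rewrite inE.
  by rewrite inE; apply/subsetP => v vH; rewrite inE /= /aperm pH.
have rE := restr_permE nH; split => //.
apply/andP; split; first exact: restr_perm_on.
apply/forall_inP => u uH; apply/forall_inP => v vH.
by rewrite !rE // -!adjH ?pH // (aut_adj _ _ pG).
Qed.

End Automorphism.

(** No new permutation is needed: an automorphism of C already fixes every point outside C. Only the
    cross edges require an argument, and rigidity settles them. *)
Lemma aut_extend_left p : automorphism C p -> automorphism (compose C R) p.
Proof.
move=> pC; have pA := separating_rigid pC; have pV v := aut_closed v pC.
have pR v : v \in vset R -> p v = v.
  move=> vR; case/andP: (pC) => pon _; apply: (out_perm pon).
  by rewrite (disjointFl djCR vR).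
apply/andP; split.
  case/andP: pC => /subset_trans pon _; apply: pon; exact: subsetUl.
apply/forall_inP => u uG; apply/forall_inP => v vG; apply/eqP; move: uG vG.
rewrite !vset_compose => /orP[uC|uR] /orP[vC|vR].
- by rewrite !adj_compose_left ?pV // (aut_adj _ _ pC).
- by rewrite (pR v) // !adj_compose_cross ?pV ?pA.
- by rewrite (pR u) // ![adj _ u _]adj_sym !adj_compose_cross ?pV ?pA.
by rewrite !pR.
Qed.

(** All vertices of R have the same neighbours in C, so permuting them preserves the cross edges. *)
Lemma aut_extend_right p : automorphism R p -> automorphism (compose C R) p.
Proof.
move=> pR; have pV v := aut_closed v pR.
have pC v : v \in vset C -> p v = v.
  move=> vC; case/andP: (pR) => pon _; apply: (out_perm pon).
  by rewrite (disjointFr djCR vC).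
apply/andP; split.
  case/andP: pR => /subset_trans pon _; apply: pon; exact: subsetUr.
apply/forall_inP => u uG; apply/forall_inP => v vG; apply/eqP; move: uG vG.
rewrite !vset_compose => /orP[uC|uR] /orP[vC|vR].
- by rewrite !pC.
- by rewrite (pC u) // !adj_compose_cross ?pV.
- by rewrite (pC v) // ![adj _ _ v]adj_sym !adj_compose_cross ?pV.
by rewrite !adj_compose_right ?pV // (aut_adj _ _ pR).
Qed.

Lemma distinguishing_extend H phi : vset H \subset vset (compose C R) ->
    (forall p, automorphism H p -> automorphism (compose C R) p) ->
  distinguishing (compose C R) phi -> distinguishing H phi.
Proof.
move=> sH ext dG; apply/forallP => p; apply/implyP => /andP[pH p1].
have /exists_inP[v _ nphi] := implyP (forallP dG p) (introT andP (conj (ext p pH) p1)).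
apply/exists_inP; exists v => //; apply: contraNT nphi => nvH.
by case/andP: pH => pon _; rewrite (out_perm pon nvH).
Qed.

Lemma distinguishing_restrict H phi p : automorphism (compose C R) p ->
    automorphism H (restr_perm (vset H) p) /\
      {in vset H, restr_perm (vset H) p =1 p} ->
    distinguishing H phi -> {in vset H, forall v, phi (p v) = phi v} ->
  {in vset H, forall v, p v = v}.
Proof.
move=> pG [rH rE] dH phiE v vH.
have [r1|rn1] := eqVneq (restr_perm (vset H) p) 1%g.
  by rewrite -rE // r1 perm1.
have /exists_inP[u uH] := implyP (forallP dH _) (introT andP (conj rH rn1)).
by rewrite rE // phiE // eqxx.
Qed.

(** A label-preserving automorphism of C o R restricts to label-preserving automorphisms of C and R;
    both are trivial, so it is the identity. *)
Lemma distinguishing_compose phi :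
  distinguishing (compose C R) phi <-> distinguishing C phi /\ distinguishing R phi.
Proof.
split=> [dG|[dC dR]].
  split; apply: distinguishing_extend dG; first exact: subsetUl.
  - exact: aut_extend_left.
  - exact: subsetUr.
  exact: aut_extend_right.
apply/forallP => p; apply/implyP => /andP[pG]; apply: contraR => /exists_inPn nphi.
have phiE v : v \in vset (compose C R) -> phi (p v) = phi v.
  by move=> /nphi; rewrite negbK => /eqP.
have pC := distinguishing_restrict pG
  (restr_aut pG adj_compose_left (aut_compose_left pG)) dC.
have pR := distinguishing_restrict pG
  (restr_aut pG adj_compose_right (aut_compose_right pG)) dR.
apply/eqP/permP => v; rewrite perm1.
have [vG|nvG] := boolP (v \in vset (compose C R)); last first.
  by case/andP: pG => pon _; rewrite (out_perm pon nvG).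
move: vG; rewrite vset_compose => /orP[]; [apply: pC | apply: pR] => u uS;
  by apply: phiE; rewrite vset_compose uS ?orbT.
Qed.

End Compose.

(** * Distinguishing numbers of compositions *)

Lemma eq_distinguishing G phi psi : {in vset G, phi =1 psi} ->
  distinguishing G phi -> distinguishing G psi.
Proof.
move=> e dG; apply/forall_inP => p pG; move: (pG) => /andP[pA _].
have /exists_inP[v vG neq] := forall_inP dG p pG.
by apply/exists_inP; exists v => //; rewrite -!e ?aut_closed.
Qed.

(** A c-labeling is also a labeling for every larger bound, so the feasible bounds form an up-set
    and the minimum describes it. *)
Lemma distinguishing_number_leq G c :
  (distinguishing_number G <= c) = has_distinguishing_labeling G c.
Proof.
rewrite /distinguishing_number; case: ex_minnP => m hm min_m.
apply/idP/idP => [le_mc|]; last exact: min_m.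
have [phi lphi dphi] := has_distinguishing_labelingP G m hm.
apply/has_distinguishing_labelingP; exists phi => //.
apply/forall_inP => v /(forall_inP lphi)/andP[-> le_m].
exact: leq_trans le_mc.
Qed.

Lemma distinguishing_number_compose C R : separating C R ->
  distinguishing_number (compose C R) =
  maxn (distinguishing_number C) (distinguishing_number R).
Proof.
move=> [djCR nR sepCR]; have dE := distinguishing_compose djCR nR sepCR.
(* Two numbers with the same upper bounds are equal. *)
suff leE c : (distinguishing_number (compose C R) <= c) =
    (maxn (distinguishing_number C) (distinguishing_number R) <= c).
  by apply/eqP; rewrite eqn_leq leE leqnn -leE leqnn.
rewrite geq_max !distinguishing_number_leq.
apply/has_distinguishing_labelingP/andP => [[phi lphi /dE[dC dR]]|[]].
  split; apply/has_distinguishing_labelingP; exists phi => //;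
    apply/forall_inP => v vS; apply: (forall_inP lphi);
    by rewrite vset_compose vS ?orbT.
move=> /has_distinguishing_labelingP[f lf df].
move=> /has_distinguishing_labelingP[g lg dg].
(* Disjointness lets the labelings of C and R be glued without conflict. *)
pose phi v := if v \in vset C then f v else g v.
have phiC : {in vset C, f =1 phi} by move=> v vC; rewrite /phi vC.
have phiR : {in vset R, g =1 phi}.
  by move=> v vR; rewrite /phi (disjointFl djCR vR).
exists phi.
  apply/forall_inP => v; rewrite vset_compose => /orP[vC|vR].
    by rewrite -phiC // (forall_inP lf).
  by rewrite -phiR // (forall_inP lg).
by apply/dE; split; [apply: eq_distinguishing df | apply: eq_distinguishing dg].
Qed.

(** * Iterated compositions and canonical decompositions *)

Section Decompositions.
Implicit Types (cs ds : seq (split_graph T)).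

Local Notation composition cs G := (foldr (@compose T) G cs).

(** Components are numbered from the right end, so prepending one does not shift the others. *)
Lemma component_cons C cs G i :
  i <= size cs -> component (C :: cs) G i = component cs G i.
Proof.
move=> le_i; rewrite /component /= rev_cons -rcons_cons nth_rcons /=.
by rewrite size_rev size_map ltnS le_i.
Qed.

Lemma component_head C cs G : component (C :: cs) G (size cs).+1 = C.
Proof.
by rewrite /component /= rev_cons nth_rcons size_rev size_map ltnn eqxx.
Qed.

Fixpoint all_separating cs G : Prop :=
  if cs is C :: cs' then separating C (composition cs' G) /\ all_separating cs' G
  else True.

Lemma distinguishing_composition cs G phi : all_separating cs G ->
  distinguishing (composition cs G) phi <->
  (forall i, i <= size cs -> distinguishing (component cs G i) phi).
Proof.
elim: cs => [_|C cs IH /= [[dj n0 sep] /IH{}IH]].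
  by split=> [dG [|//] _ //|d]; apply: (d 0).
split=> [/(distinguishing_compose dj n0 sep)[dC /IH dR] i|d].
  rewrite leq_eqVlt => /orP[/eqP->|]; first by rewrite component_head.
  by rewrite ltnS => le_i; rewrite component_cons //; apply: dR.
apply/(distinguishing_compose dj n0 sep); split.
  by rewrite -(component_head C cs G); apply: d.
by apply/IH => i le_i; rewrite -(component_cons C) //; apply: d; apply: leqW.
Qed.

Lemma distinguishing_number_composition cs G : all_separating cs G ->
  distinguishing_number (composition cs G) =
  \max_(i < (size cs).+1) distinguishing_number (component cs G i).
Proof.
elim: cs => [_|C cs IH /= [sep /IH{}IH]]; first by rewrite big_ord1.
rewrite distinguishing_number_compose // IH maxnC [RHS]big_ord_recr.
congr maxn; last by rewrite -(component_head C cs G).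
by apply: eq_bigr => i _; rewrite component_cons //; apply: (ltn_ord i).

Qed.

(* The graph without vertices is excluded: it has a canonical decomposition,  *)
(* but an empty component.                                                    *)
Fixpoint nonempty_canonical cs G : Prop :=
  if cs is C :: cs' then
    [/\ [disjoint vset C & vset (composition cs' G)], vset C != set0,
        ~ decomposable C & nonempty_canonical cs' G]
  else ~ decomposable G /\ vset G != set0.

Lemma canonical_decompositionW G cs G0 : 0 < size cs ->
  canonical_decomposition G cs G0 ->
  G = composition cs G0 /\ nonempty_canonical cs G0.
Proof.
move=> cs_gt0 [-> dj ind /(_ cs_gt0) n0]; split=> // {cs_gt0}.
elim: cs dj ind n0 => [_ ind n0|C cs IH]; first by split; [apply: (ind 0)|apply: (n0 0)].
rewrite /= => /andP[djC dj] ind n0; split.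
(* Disjointness from each later component is collected into disjointness from their union. *)
- elim: cs djC {IH dj ind n0} => [|D cs IH] /=; first by rewrite andbT.
  by case/andP=> djD /IH djR; rewrite -setI_eq0 setIUr setU_eq0 !setI_eq0 djD.
- by have := n0 _ (leqnn _); rewrite component_head.
- by have := ind _ (leqnn _); rewrite component_head.
apply: IH => // i le_i; rewrite -(component_cons C) //.
  by apply: ind; apply: leqW.
by apply: n0; apply: leqW.
Qed.

Lemma nonempty_composition cs G :
  nonempty_canonical cs G -> vset (composition cs G) != set0.
Proof.
case: cs => [[_ //]|C cs /= [_ /set0Pn[v vC] _ _]].
by apply/set0Pn; exists v; rewrite inE vC.
Qed.

(** * Merging trivial components of equal type *)

Definition typed_split (b : bool) S : split_graph T :=
  if b then complete_split S else edgeless_split S.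

Definition typed_graph (b : bool) S : graph T :=
  if b then complete_graph S else edgeless_graph S.

(** As in [component_type], [true] stands for K_1 and [false] for S_1; the side of the partition
    opposite to the type is empty. *)
Definition typed (b : bool) C := (if b then stable C else clique C) = set0.

Lemma vset_typed_graph b S : vset (typed_graph b S) = S.
Proof. by case: b. Qed.

Lemma adj_typed_graph b S u v :
  adj (typed_graph b S) u v = [&& b, u != v, u \in S & v \in S].
Proof.
case: b => /=; last by rewrite /adj /= inE.
by rewrite /adj /= inE cards2 subUset !sub1set; case: (u != v).
Qed.

Lemma typed_typed_split b S : typed b (typed_split b S).
Proof. by case: b. Qed.

Lemma typed_clique b C v : typed b C -> (v \in clique C) = b && (v \in vset C).
Proof.
by rewrite /typed vsetE; case: b => [->|->]; rewrite !inE ?orbF.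
Qed.

Lemma typed_adj b C u v : typed b C ->
  adj C u v = [&& b, u != v, u \in vset C & v \in vset C].
Proof.
move=> tC; apply/idP/and4P => [uv|[b1 uv uC vC]]; last first.
  by apply: clique_adj => //; rewrite (typed_clique _ tC) b1.
have [uC vC] := (adj_vsetl uv, adj_vsetr uv); split; rewrite ?(adj_neq uv) //.
have := typed_clique u tC; rewrite uC andbT => <-.
case: b tC => tC; first by rewrite (typed_clique u tC).
have sE w : w \in vset C -> w \in stable C by rewrite vsetE tC set0U.
by rewrite stable_nadj ?sE in uv.
Qed.

Lemma component_type_typed b C : component_type C = Some b -> typed b C.
Proof.
rewrite /component_type /trivial_graph; case: ifP => // /cards1P[v vC] [<-].
rewrite /typed; case: (set_0Vmem (clique C)) => [->|[w wA]]; first by rewrite eqxx.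
have -> : clique C != set0 by apply/set0Pn; exists w.
apply/setP => u; rewrite inE; apply/negP => uB; move: (cliqueF uB).
move: (clique_vset wA) (stable_vset uB); rewrite vC => /set1P wv /set1P uv.
by rewrite uv -wv wA.
Qed.

Lemma component_type_None C : component_type C = None -> vset C != set0 ->
  1 < #|vset C|.
Proof.
rewrite /component_type /trivial_graph; case: ifP => // + _; rewrite -card_gt0.
by case: #|_| => [|[]].
Qed.

(** On one vertex, complete and edgeless coincide, so a trivial last component can take either
    type. *)
Lemma trivial_graphE b G : trivial_graph G -> G = typed_graph b (vset G).
Proof.
move/cards1P=> [v vG]; apply: graph_ext => [|u w]; first by rewrite vset_typed_graph.
rewrite adj_typed_graph vG !inE; apply/idP/and4P => [uw|[_ uw /eqP uv /eqP wv]].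
  move: (adj_vsetl uw) (adj_vsetr uw) (adj_neq uw).
  by rewrite vG => /set1P-> /set1P->; rewrite eqxx.
by rewrite uv wv eqxx in uw.
Qed.

Lemma compose_typed b C S : typed b C ->
  compose C (typed_graph b S) = typed_graph b (vset C :|: S).
Proof.
move=> tC; apply: graph_ext => [|u v]; first by rewrite /= !vset_typed_graph.
rewrite adj_compose !adj_typed_graph (typed_adj _ _ tC) !(typed_clique _ tC).
rewrite vset_typed_graph !inE.
case: b {tC}; rewrite ?andbF //=; case: (u != v) => //=.
by case: (u \in vset C); case: (v \in vset C); case: (u \in S); case: (v \in S).
Qed.

(** Associativity specialised to two runs of one type: two cliques joined completely form a clique,
    two stable sets left unjoined form a stable set, and their links to R are alike. *)
Lemma compose_typedA b C D R : typed b C -> typed b D ->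
  compose C (compose D R) = compose (typed_split b (vset C :|: vset D)) R.
Proof.
move=> tC tD; have tS := typed_typed_split b (vset C :|: vset D).
have vS : vset (typed_split b (vset C :|: vset D)) = vset C :|: vset D.
  by case: b {tC tD tS}.
apply: graph_ext => [|u v]; first by rewrite /= vS setUA.
rewrite !adj_compose (typed_adj _ _ tC) (typed_adj _ _ tD) (typed_adj _ _ tS).
rewrite !(typed_clique _ tC) !(typed_clique _ tD) !(typed_clique _ tS) vS !inE.
case: b {tC tD tS vS} => //=; last by rewrite !andbF !orbF.
case: (u != v) => //=; last by rewrite !orbF.
case: (adj R u v); rewrite ?orbT //=.
by case: (u \in vset C); case: (v \in vset C); case: (u \in vset D);
   case: (v \in vset D); case: (u \in vset R); case: (v \in vset R).
Qed.

(** A stable vertex of C and a vertex of R are never adjacent, which rules out both kinds; clique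
    vertices are covered by the hypothesis. *)
Lemma compose_no_dominating C R :
    [disjoint vset C & vset R] -> vset R != set0 -> stable C != set0 ->
    {in clique C, forall a,
      exists2 u, u \in vset C & (u != a) && ~~ adj C a u} ->
  no_dominating (compose C R).
Proof.
move=> dj /set0Pn[r rR] /set0Pn[b bB] ndom v; have bC := stable_vset bB.
have neqCR u w : u \in vset C -> w \in vset R -> u != w.
  by move=> uC; apply: contraTneq => <-; rewrite (disjointFr dj uC).
rewrite vset_compose vsetE inE => /orP[/orP[vA|vB]|vR].
- have [u uC /andP[uv nvu]] := ndom v vA; exists u; first by rewrite vset_compose uC.
  by rewrite uv adj_compose_left // clique_vset.
- have vC := stable_vset vB; exists r; first by rewrite vset_compose rR orbT.
  by rewrite eq_sym neqCR // adj_compose_cross // cliqueF.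
exists b; first by rewrite vset_compose bC.
by rewrite neqCR // adj_sym adj_compose_cross // cliqueF.
Qed.

Lemma compose_no_isolated C R :
    [disjoint vset C & vset R] -> vset R != set0 -> clique C != set0 ->
    {in stable C, forall b, exists u, adj C b u} ->
  no_isolated (compose C R).
Proof.
move=> dj /set0Pn[r rR] /set0Pn[a aA] niso v; have aC := clique_vset aA.
rewrite vset_compose vsetE inE => /orP[/orP[vA|vB]|vR].
- by exists r; rewrite adj_compose_cross // clique_vset.
- have [u vu] := niso v vB; exists u.
  by rewrite adj_compose_left // (adj_vsetl vu, adj_vsetr vu).
by exists a; rewrite adj_sym adj_compose_cross.
Qed.

(** What R must satisfy for a run of type b in front of it to be separating. *)
Definition lacks_extremal (b : bool) R :=
  if b then no_dominating R else no_isolated R.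

Lemma indecomposable_lacks_extremal b G :
  ~ decomposable G -> 1 < #|vset G| -> lacks_extremal b G.
Proof.
by case: b; [exact: indecomposable_no_dominating|exact: indecomposable_no_isolated].
Qed.

Lemma compose_lacks_extremal b C R :
    [disjoint vset C & vset R] -> vset R != set0 -> vset C != set0 ->
    lacks_extremal b C \/ typed (~~ b) C ->
  lacks_extremal b (compose C R).
Proof.
move=> dj nR /set0Pn[v vC] H.
have vAB : (v \in clique C) || (v \in stable C) by rewrite -in_setU -vsetE.
case: b H => H; rewrite /lacks_extremal.
  apply: compose_no_dominating => //.
    (* If [v] is a clique vertex, the vertex it misses must be stable. *)
    apply/set0Pn; have [vB|vnB] := boolP (v \in stable C); first by exists v.
    case: H => [ndom|A0]; last by rewrite [clique C]A0 inE (negbTE vnB) in vAB.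
    have vA : v \in clique C by rewrite (negbTE vnB) orbF in vAB.
    have [u + /andP[uv]] := ndom v vC; rewrite vsetE inE => /orP[uA|]; last by exists u.
    by rewrite clique_adj // eq_sym.
  move=> a aA; case: H => [ndom|A0]; last by rewrite [clique C]A0 inE in aA.
  exact: ndom (clique_vset aA).
apply: compose_no_isolated => //.
  apply/set0Pn; have [vA|vnA] := boolP (v \in clique C); first by exists v.
  case: H => [niso|B0]; last by rewrite [stable C]B0 inE (negbTE vnA) in vAB.
  have vB : v \in stable C by rewrite (negbTE vnA) in vAB.
  have [u vu] := niso v vC; have := adj_vsetr vu; rewrite vsetE inE.
  by case/orP=> [|uB]; [exists u | rewrite stable_nadj in vu].
move=> b bB; case: H => [niso|B0]; last by rewrite [stable C]B0 inE in bB.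
exact: niso (stable_vset bB).
Qed.

(** Where a run of type b ends, the next component either has at least two vertices and is
    indecomposable, or is a single vertex of the opposite type. A trivial last component directly
    after C would inherit type b, so it cannot occur here. *)
Lemma next_type_lacks_extremal b C cs G : nonempty_canonical cs G ->
  component_type C = Some b -> next_type C cs G != Some b ->
  lacks_extremal b (composition cs G).
Proof.
case: cs => [|D cs] /= [].
  rewrite /trivial_graph => indG nG ->; case: ifP; first by rewrite eqxx.
  move=> nt _; apply: indecomposable_lacks_extremal => //.
  by move: nt nG; rewrite -card_gt0; case: #|_| => [|[]].
move=> dj nD indD canR _ tD.
apply: compose_lacks_extremal => //; first exact: nonempty_composition canR.
case eD : (component_type D) tD => [b'|] tD.
  right; apply: component_type_typed; rewrite eD; congr Some.
  by case: b b' tD {eD} => [] [].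
left; apply: indecomposable_lacks_extremal => //.
exact: component_type_None.
Qed.

(** A nonempty run cannot be [tight], since the required witness would lie on its empty side. The
    converse direction recovers the condition on R, which can then be passed to a longer run. *)
Lemma typed_separating b D R : typed b D -> vset D != set0 ->
  separating D R <->
  [/\ [disjoint vset D & vset R], vset R != set0 & lacks_extremal b R].
Proof.
move=> tD /set0Pn[v vD]; split=> [[dj nR sep]|[dj nR ext]]; split => //; last first.
  by case: b tD ext => tD ext; [apply: Or32 | apply: Or33].
have vAB : (v \in clique D) || (v \in stable D) by rewrite -in_setU -vsetE.
case: b tD; rewrite /typed => D0; rewrite D0 inE ?orbF in vAB.
  case: sep => [[/(_ v vAB)[u]]|[]//|[A0]]; first by rewrite D0 inE.
  by rewrite A0 inE in vAB.
case: sep => [[_ /(_ v vAB)[u]]|[B0]|[]//]; first by rewrite D0 inE.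
by rewrite B0 inE in vAB.
Qed.

(* The last clause concerns a component [C] about to be put in front of [cs], *)
(* and says that [C] has something of its own type to be merged with.         *)
Lemma compact_spec cs G : nonempty_canonical cs G ->
  let: (ds, H) := compact cs G in
  [/\ composition ds H = composition cs G, all_separating ds H &
    forall C b, next_type C cs G = Some b -> component_type C = Some b ->
      if ds is D :: _ then typed b D /\ vset D != set0
      else H = typed_graph b (vset H)].
Proof.
elim: cs => [_|C cs IH] /=.
  by split=> // C b; case: ifP => // /(trivial_graphE b).
move=> [dj nC indC can]; move: IH => /(_ can).
case: (compact cs G) => ds H [eR sepR headR].
have nR := nonempty_composition can.
(* The case where C stays a component of its own, because its type differs from the next one or
   because it is nontrivial. *)
have keep : next_type C cs G != component_type C \/ component_type C = None ->
  [/\ composition (C :: ds) H = composition (C :: cs) G,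
     all_separating (C :: ds) H &
     forall b, component_type C = Some b -> typed b C /\ vset C != set0].
  move=> nt; rewrite /= eR; split=> //; last first.
    by move=> b /component_type_typed.
  split=> //; case tC : (component_type C) nt => [b|] nt; last first.
    by split=> //; apply: Or31; apply/indecomposable_tight/component_type_None.
  apply/(typed_separating _ (component_type_typed tC) nC); split=> //.
  by case: nt => // nt; apply: next_type_lacks_extremal nt.
case tC : (component_type C) keep => [b|] keep; last first.
  by case: keep => [|? ? _]; [right | split].
have typC := component_type_typed tC.
case: eqP => nt; last first.
  case: keep => [|eR' sepR' typedC]; first by left; apply/eqP.
  by case: ds {eR sepR headR} eR' sepR' => [|D ds]; split=> // C' b' /typedC.
(* C is merged: into the last component if no split component remains, otherwise into the leading
   run D. *)
have := headR C b nt tC; case: ds eR sepR {headR keep} => [|D ds] eR sepR hd.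
  split=> //= [|C' b' [<-] _]; last by rewrite -/(typed_graph _ _) vset_typed_graph.
  by rewrite -eR /= [in RHS]hd compose_typed.
case: hd => typD nD; case: sepR => sepD sepR.
have typS := typed_typed_split b (vset C :|: vset D).
have vS : vset (typed_split b (vset C :|: vset D)) = vset C :|: vset D.
  by case: b {tC typC nt typD typS}.
have nS : vset (typed_split b (vset C :|: vset D)) != set0.
  by rewrite vS setU_eq0 negb_and nC.
split=> /=; first by rewrite -eR /= (compose_typedA _ typC typD).
- split=> //; apply/(typed_separating _ typS nS); rewrite vS.
  (* The condition on the graph after D depends only on the type, so it serves the enlarged run as
     well. *)
  have [djD nR' ext] := (typed_separating _ typD nD).1 sepD; split=> //.
  rewrite -setI_eq0 setIUl setU_eq0 !setI_eq0 djD andbT.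
  move: dj; rewrite -eR /= -!setI_eq0 setIUr setU_eq0.
  by case/andP.
by move=> C' b' [<-].
Qed.

End Decompositions.
End Graphs.

Theorem theorem3p4 (T : finType) (G : graph T)
    (cs : seq (split_graph T)) (G0 : graph T) :
  compact_canonical_decomposition G cs G0 ->
  (forall (c : nat) (phi : T -> nat), labeling c G phi ->
     (distinguishing G phi <->
      (forall i : nat, i <= size cs ->
         distinguishing (component cs G0 i) phi))) /\
  distinguishing_number G =
    \max_(i < (size cs).+1) distinguishing_number (component cs G0 i).
Proof.
move=> [ds [H [canG eC]]].
suff [-> sep] : G = foldr (@compose T) G0 cs /\ all_separating cs G0.
  split=> [c phi _|]; first exact: distinguishing_composition.
  exact: distinguishing_number_composition.
(* With a single component, compaction changes nothing; this case also covers the graph without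
   vertices. *)
case: ds canG eC => [[-> _ _ _] [<- <-]//|C ds canG eC].
have [-> can] := canonical_decompositionW (cs := C :: ds) isT canG.
by have := compact_spec can; rewrite eC => -[].
Qed.
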